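(* For every integer $n\ge 7$, the matrix $C_n$ is $(k-1,k-1,1)$-coverable for $k=\sigma(n)$. In particular, for all integers $n,m\ge 7$, $\mathrm{R}_{\mathbb{B}}(C_n\otimes C_m)<\mathrm{R}_{\mathbb{B}}(C_n)\cdot\mathrm{R}_{\mathbb{B}}(C_m)$.
   Context: $C_n$ is the $n\times n$ $0,1$-matrix with zeros on the diagonal and ones elsewhere. $\sigma(n)=\min\{k : n\le\binom{k}{\lceil k/2\rceil}\}$. The Boolean rank $\mathrm{R}_{\mathbb{B}}(A)$ of a $0,1$-matrix is the smallest number of all-ones combinatorial rectangles needed to cover its $1$-entries. A collection of $0,1$-matrices covers $A$ if $A_{i,j}=1$ iff some matrix of the collection has a $1$ in entry $(i,j)$. $A$ is $(a_1,a_2,a_3)$-coverable if there exist three matrices $A_1,A_2,A_3$ with $\mathrm{R}_{\mathbb{B}}(A_i)\le a_i$ for all $i$ such that every two of them cover $A$. The Kronecker product $A\otimes B$ is the block matrix with $(i,j)$-th block $A_{i,j}B$. *)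

(* Defs.v *)
From mathcomp Require Import all_boot all_order all_algebra.
From mathcomp Require Import mxtens.

Set Implicit Arguments.
Unset Strict Implicit.
Unset Printing Implicit Defensive.

(* 0,1-matrices are matrices over bool, with true standing for 1. The product
   of the ring structure on bool is conjunction, so that the Kronecker product
   A *t B from mxtens is the one of 0,1-matrices. The addition of that ring is
   exclusive or; it is used nowhere below. *)

Definition cmx (n : nat) : 'M[bool]_n := \matrix_(i, j) (i != j).

Lemma sigma_ex (n : nat) : exists k, n <= 'C(k, uphalf k).
Proof.
exists n.*2; rewrite uphalf_double.
elim: n => // n IHn; rewrite doubleS !binS.
have lt0 : 0 < 'C(n.*2, n.+1) + 'C(n.*2, n).
  by rewrite addn_gt0 orbC bin_gt0 -addnn leq_addr.
have lt1 : n <= 'C(n.*2, n) by [].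
rewrite -addn1 addnC leq_add // (leq_trans lt1) //.
by case: n {IHn lt0 lt1} => // n; rewrite binS leq_addr.
Qed.

Definition sigma (n : nat) : nat := ex_minn (sigma_ex n).

Section BooleanRank.

Variables m n : nat.

Definition rectangle : Type := ({set 'I_m} * {set 'I_n})%type.

Definition ones_rectangle (A : 'M[bool]_(m, n)) (r : rectangle) : bool :=
  [forall i in r.1, forall j in r.2, A i j].

Definition rectangle_cover (A : 'M[bool]_(m, n)) (F : {set rectangle}) : bool :=
  [forall r in F, ones_rectangle A r] &&
  [forall i, forall j, A i j ==> [exists r in F, (i \in r.1) && (j \in r.2)]].

Lemma rectangle_cover_ex (A : 'M[bool]_(m, n)) :
  exists k, [exists F : {set rectangle}, rectangle_cover A F && (#|F| == k)].
Proof.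
exists #|[set r | ones_rectangle A r]|; apply/existsP.
exists [set r | ones_rectangle A r]; rewrite eqxx andbT; apply/andP; split.
  by apply/forall_inP => r; rewrite inE.
apply/forallP => i; apply/forallP => j; apply/implyP => Aij.
apply/existsP; exists ([set i], [set j]); rewrite !inE !eqxx !andbT.
by apply/forall_inP => i' /set1P ->; apply/forall_inP => j' /set1P ->.
Qed.

Definition brank (A : 'M[bool]_(m, n)) : nat := ex_minn (rectangle_cover_ex A).

Definition covers (s : seq 'M[bool]_(m, n)) (A : 'M[bool]_(m, n)) : Prop :=
  forall i j, A i j <-> (exists2 B, B \in s & B i j).

Definition coverable (a1 a2 a3 : nat) (A : 'M[bool]_(m, n)) : Prop :=
  exists A1 A2 A3 : 'M[bool]_(m, n),
    [/\ brank A1 <= a1, brank A2 <= a2 & brank A3 <= a3] /\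
    [/\ covers [:: A1; A2] A, covers [:: A1; A3] A & covers [:: A2; A3] A].

End BooleanRank.

(* Main.v *)
Require Import Defs.
From mathcomp Require Import all_boot all_order all_algebra.
From mathcomp Require Import mxtens.
From mathcomp Require Import zify.

Set Implicit Arguments.
Unset Strict Implicit.
Unset Printing Implicit Defensive.

(** Indexing a cover of [cmx n] by [k] rectangles as an assignment of subsets
   of a [k]-set to the rows, the rows must receive pairwise incomparable sets,
   so Sperner's theorem gives [sigma n <= brank (cmx n)].

   With one rectangle less, label the rows injectively by sets from the two
   middle levels [t - 1] and [t] of a [(k - 1)]-set, where [t = k./2]. Only the
   inclusions from the lower level to the upper one are then lost, and these lie
   in a single rectangle [A3]. A second labelling permutes the upper level by
   some [rho] with [#|y :&: rho y| < t - 1], so that no inclusion is lost twice: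
   [rho] is complementation when [k] is odd, and complementation followed by a
   perfect matching of the two middle levels when [k] is even. That matching is
   the one of the bracketing chain decomposition, which also proves Sperner's
   theorem.

   Each 1-entry of a coverable matrix lies in two of its three parts. Hence
   [A1 *t B1], [A2 *t B3], [A3 *t B2] cover the Kronecker product, with
   [(k - 1) * (l - 1) + (k - 1) + (l - 1) = k * l - 1] rectangles. *)

(** * The bracketing matching *)

Section Matching.

Variable m : nat.
Implicit Types (z w y : {set 'I_m}) (i j : nat).

(* Up to the constant [2 * #|z|], the height after [i] steps of the walk that
   goes down at the elements of [z] and up elsewhere. *)
Definition height z i := i + (#|[set r in z | i <= r]|).*2.

Definition last_argmin z (j : 'I_m) :=
  [forall i : 'I_m.+1, (height z j <= height z i) &&
     ((j < i) ==> (height z j < height z i))].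

(** With elements of [z] read as closing brackets and the others as opening ones, this closes the
    first unmatched opening bracket; [z] is the default when there is none. *)
Definition match_up z := if [pick j | last_argmin z j] is Some j then j |: z else z.

Lemma height0 z : height z 0 = (#|z|).*2.
Proof.
by rewrite /height add0n; congr (_.*2); apply: eq_card => r; rewrite !inE andbT.
Qed.

Lemma heightm z : height z m = m.
Proof.
rewrite /height (_ : [set r in z | m <= r] = set0) ?cards0 ?addn0 //.
by apply/setP=> r; rewrite !inE leqNgt ltn_ord andbF.
Qed.

Lemma height_succ z (j : 'I_m) : (height z j.+1 + (j \in z).*2 = (height z j).+1)%N.
Proof.
have E : [set r in z | j <= r] :\ j = [set r in z | j < r].
  apply/setP=> r; rewrite !inE ltn_neqAle andbCA; congr (_ && (_ && _)).
  by rewrite eq_sym.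
have := cardsD1 j [set r in z | j <= r]; rewrite E !inE leqnn andbT /height.
by move->; move: #|[set r in z | j < r]| => c; lia.
Qed.

Lemma height_add z (j : 'I_m) i : j \notin z ->
  height (j |: z) i = height z i + (i <= j).*2.
Proof.
move=> jz; rewrite /height -addnA -doubleD; congr (_ + _.*2).
have [ij|ij] := leqP i j; last first.
  rewrite addn0; apply: eq_card => r; rewrite !inE.
  by case: eqP => //= ->; rewrite leqNgt ij andbF.
rewrite (_ : [set r in j |: z | i <= r] = j |: [set r in z | i <= r]).
  by rewrite cardsU1 !inE (negPf jz) addnC.
by apply/setP=> r; rewrite !inE; case: eqP => //= ->.
Qed.

Lemma ex_last_argmin (h : nat -> nat) d :
  exists2 j, j <= d & forall i, i <= d -> h j <= h i /\ (j < i -> h j < h i).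
Proof.
elim: d => [|d [j jd IH]]; first by exists 0 => // -[].
have [hd|hd] := leqP (h d.+1) (h j); [exists d.+1 => // i id | exists j => [|i id]].
- have [->|idd] := eqVneq i d.+1; first by split; lia.
  by have [|h1 h2] := IH i; first lia; split; lia.
- lia.
- have [->|idd] := eqVneq i d.+1; first by split; lia.
  by apply: IH; lia.
Qed.

Lemma match_upP z : (#|z|).*2 < m -> exists j : 'I_m,
  [/\ j \notin z, match_up z = j |: z,
      forall i, i <= j -> height (match_up z) j.+1 < height (match_up z) i &
      forall i, j < i <= m -> height (match_up z) j.+1 <= height (match_up z) i].
Proof.
move=> zm; have [j jm jmin] := ex_last_argmin (height z) m.
(* The walk ends above its start, since [2 * #|z| < m], so its last minimum is not at [m]. *)
have {}jm : j < m.
  rewrite ltn_neqAle jm andbT; apply/eqP=> E; have [] := jmin 0 isT.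
  by rewrite E heightm height0; lia.
rewrite /match_up; case: pickP => [j' /forallP jP|/(_ (Ordinal jm))]; last first.
  move/negP; case; apply/forallP=> i; have [|h1 h2] := jmin i.
    by rewrite -ltnS.
  by rewrite h1; apply/implyP.
have minP i : i <= m -> height z j' <= height z i /\ (j' < i -> height z j' < height z i).
  by rewrite -ltnS => im; have /andP[h1 /implyP h2] := jP (Ordinal im).
have [_ /(_ (leqnn _)) up] := minP j'.+1 (ltn_ord _).
have := height_succ z j'.
have j'z : j' \notin z by apply/negP => jz; have := height_succ z j'; rewrite jz; lia.
(* Adding [j'] raises the heights up to [j'] by 2 and keeps the later ones, so [j'.+1] becomes the
   first minimum. *)
rewrite (negPf j'z) addn0 => hS; exists j'; split=> // i.
  move=> ij; rewrite !height_add // ij ltnn hS.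
  by have [|] := minP i; [have := ltn_ord j'; lia | lia].
case/andP=> ji im; rewrite !height_add // ltnn hS (leqNgt i j') ji.
by have [_ /(_ ji)] := minP i im; lia.
Qed.

Lemma sub_match_up z : z \subset match_up z.
Proof. by rewrite /match_up; case: pickP => // j _; rewrite subsetUr. Qed.

Lemma card_match_up z : (#|z|).*2 < m -> #|match_up z| = #|z|.+1.
Proof. by case/match_upP=> j [jz -> _ _]; rewrite cardsU1 jz. Qed.

(* The added element is recovered from the image: it is the step just before
   the first minimum of the new walk. *)
Lemma match_up_inj z w : (#|z|).*2 < m -> (#|w|).*2 < m ->
  match_up z = match_up w -> z = w.
Proof.
move=> /match_upP[j [jz Ez lz gz]] /match_upP[j' [jw Ew lw gw]] E.
rewrite -E in lw gw.
have jj : j = j'.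
  apply: val_inj => /=; case: (ltngtP j j') => // lt.
    by have := lw _ lt; have := gz j'.+1; have := ltn_ord j'; lia.
  by have := lz _ lt; have := gw j.+1; have := ltn_ord j; lia.
move: E; rewrite Ez Ew -jj => E; rewrite -jj in jw.
by rewrite -(setU1K jz) -(setU1K jw) E.
Qed.

(** * Chains and Sperner's theorem *)

Lemma iter_match_up d z : #|z| + d <= uphalf m ->
  z \subset iter d match_up z /\ #|iter d match_up z| = #|z| + d.
Proof.
elim: d => [|d IH] zd; first by rewrite addn0.
have [|sub card] := IH; first lia.
split; first exact: subset_trans sub (sub_match_up _).
by rewrite iterS card_match_up card; lia.
Qed.

Lemma iter_match_up_inj d z w : #|z| + d <= uphalf m -> #|w| + d <= uphalf m ->
  iter d match_up z = iter d match_up w -> z = w.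
Proof.
elim: d => [//|d IH] zd wd E; apply: IH; rewrite ?iterS; try lia.
have [|_ cz] := @iter_match_up d z; first lia.
have [|_ cw] := @iter_match_up d w; first lia.
by apply: match_up_inj; rewrite ?cz ?cw //; lia.
Qed.

Definition climb h z := iter (h - #|z|) match_up z.

Lemma climbP h z : #|z| <= h <= uphalf m -> z \subset climb h z /\ #|climb h z| = h.
Proof.
case/andP=> zh hm; have [|sub card] := @iter_match_up (h - #|z|) z; first lia.
by split=> //; rewrite /climb card; lia.
Qed.

(** Injectivity cancels the steps above level [#|w|], leaving [w] as an iterate of [match_up] from
    [z]. *)
Lemma climb_chain h z w : #|z| <= #|w| -> #|w| <= h <= uphalf m ->
  climb h z = climb h w -> z \subset w.
Proof.
move=> zw /andP[wh hm]; rewrite /climb.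
have -> : h - #|z| = (h - #|w|) + (#|w| - #|z|) by lia.
have [|sub card] := @iter_match_up (#|w| - #|z|) z; first lia.
by rewrite iterD => /iter_match_up_inj <- //; lia.
Qed.

(** Large sets descend by letting their complements climb to level [m./2], which is complementary to
    level [uphalf m]. *)
Definition to_middle z :=
  if #|z| <= uphalf m then climb (uphalf m) z else ~: climb m./2 (~: z).

Lemma cardsC_ord z : #|z| + #|~: z| = m.
Proof. by rewrite cardsC card_ord. Qed.

Lemma card_to_middle z : #|to_middle z| = uphalf m.
Proof.
have := cardsC_ord z; rewrite /to_middle; case: leqP => zm C.
  by have [|_ ->] := @climbP (uphalf m) z; rewrite ?zm ?leqnn.
have [|_ c] := @climbP m./2 (~: z); first lia.
by have := cardsC_ord (climb m./2 (~: z)); rewrite c; lia.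
Qed.

(** Sets on the same side of the middle lie on one chain; otherwise the common image lies between
    them. *)
Lemma to_middle_comparable z w :
  to_middle z = to_middle w -> (z \subset w) || (w \subset z).
Proof.
wlog zw : z w / #|z| <= #|w| => [W|].
  by case: (leqP #|z| #|w|) => [/W//|/ltnW/W {}W /esym/W]; rewrite orbC.
have Cz := cardsC_ord z; have Cw := cardsC_ord w.
rewrite /to_middle; case: (leqP #|w|) => wm; case: leqP => zm; try lia.
- by move=> /climb_chain -> //; lia.
- have [|sz _] := @climbP (uphalf m) z; first lia.
  have [|sw _] := @climbP m./2 (~: w); first lia.
  by move=> E; rewrite -setCS in sw; rewrite setCK -E in sw; rewrite (subset_trans sz sw).
- move/setC_inj/esym/climb_chain; rewrite setCS => -> //; lia.
Qed.

(** An antichain meets each fibre of [to_middle] at most once, and the images all lie in level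
    [uphalf m]. *)
Theorem sperner (I : finType) (a : I -> {set 'I_m}) :
  (forall i j : I, a i \subset a j -> i = j) -> #|I| <= 'C(m, uphalf m).
Proof.
move=> anti; rewrite -[X in 'C(X, _)]card_ord -card_draws.
rewrite -cardsT -(card_in_imset (f := to_middle \o a) (D := [set: I])) => [|i j _ _ /=].
  apply: subset_leq_card; apply/subsetP=> _ /imsetP[i _ ->].
  by rewrite inE /= card_to_middle.
by case/to_middle_comparable/orP=> /anti.
Qed.

(** [t.*2 - m] is the least possible overlap of two [t]-sets. For [t.*2 = m.+1] the complement is
    one element short, and [match_up] adds one, necessarily from [y]. *)
Lemma ex_level_permutation t : m <= t.*2 <= m.+1 ->
  exists rho : {set 'I_m} -> {set 'I_m},
    (forall y w, #|y| = t -> #|w| = t -> rho y = rho w -> y = w) /\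
    forall y, #|y| = t -> #|rho y| = t /\ #|y :&: rho y| = t.*2 - m.
Proof.
move=> tm; have [E|E] : t.*2 = m \/ t.*2 = m.+1 by lia.
  exists (@setC _); split=> [y w _ _|y yt]; first exact: setC_inj.
  by rewrite setICr cards0; have := cardsC_ord y; split; lia.
have low y : #|y| = t -> (#|~: y|).*2 < m by have := cardsC_ord y; lia.
exists (match_up \o @setC _); split=> [y w yt wt /=|y yt].
  by move/(match_up_inj (low _ yt) (low _ wt))/setC_inj.
have c := card_match_up (low y yt); have C := cardsC_ord y.
split; first by rewrite /= c; lia.
have := cardsD (match_up (~: y)) (~: y).
rewrite (setIidPr (sub_match_up _)) c setDE setCK setIC subSnn E => ->; lia.
Qed.

End Matching.

(** * Boolean rank *)

Section BooleanRankTheory.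

Variables m n : nat.
Implicit Types A B C : 'M[bool]_(m, n).

Lemma rectangle_coverP A (F : {set rectangle m n}) :
  reflect ((forall r, r \in F -> forall i j, i \in r.1 -> j \in r.2 -> A i j) /\
           (forall i j, A i j -> exists2 r, r \in F & (i \in r.1) && (j \in r.2)))
          (rectangle_cover A F).
Proof.
apply: (iffP andP) => -[ones cov]; split.
- move=> r rF i j ir jr; have /forall_inP/(_ _ ir) := forall_inP ones r rF.
  by move/forall_inP; apply.
- move=> i j Aij; have /forallP/(_ j)/implyP/(_ Aij)/exists_inP[r] := forallP cov i.
  by exists r.
- apply/forall_inP=> r rF; apply/forall_inP=> i ir; apply/forall_inP=> j jr.
  exact: ones rF _ _ ir jr.
- apply/forallP=> i; apply/forallP=> j; apply/implyP=> /cov[r rF rij].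
  by apply/exists_inP; exists r.
Qed.

Lemma brank_le A (F : {set rectangle m n}) : rectangle_cover A F -> brank A <= #|F|.
Proof.
by rewrite /brank; case: ex_minnP => k _ + FA; apply; apply/existsP; exists F; rewrite FA /=.
Qed.

Lemma brank_cover A : exists2 F, rectangle_cover A F & #|F| = brank A.
Proof.
by rewrite /brank; case: ex_minnP => k /existsP[F /andP[FA /eqP kF]] _; exists F.
Qed.

Lemma brank_le_family A (I : finType) (g : I -> rectangle m n) :
  (forall x i j, i \in (g x).1 -> j \in (g x).2 -> A i j) ->
  (forall i j, A i j -> exists x, (i \in (g x).1) && (j \in (g x).2)) ->
  brank A <= #|I|.
Proof.
move=> ones cov; rewrite -cardsT; apply: leq_trans (leq_imset_card g _); apply: brank_le.
apply/rectangle_coverP; split=> [_ /imsetP[x _ ->]|i j /cov[x xij]]; first exact: ones.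
by exists (g x); rewrite // imset_f.
Qed.

Lemma brank_union A B C :
  (forall i j, A i j = B i j || C i j) -> brank A <= brank B + brank C.
Proof.
have [F /rectangle_coverP[oF cF] <-] := brank_cover B.
have [G /rectangle_coverP[oG cG] <-] := brank_cover C.
move=> E; apply: (@leq_trans #|F :|: G|); last by rewrite cardsU leq_subr.
apply: brank_le.
apply/rectangle_coverP; split=> [r rFG i j ir jr|i j].
  rewrite E; case/setUP: rFG => [/oF|/oG] => o; rewrite (o _ _ ir jr) ?orbT //.
by rewrite E => /orP[/cF|/cG] [r rH rij]; exists r => //; rewrite inE rH ?orbT.
Qed.

Lemma coversP A B C : covers [:: A; B] C <-> forall i j, C i j = A i j || B i j.
Proof.
split=> [cov i j|E i j].
  apply/idP/orP=> [/cov[D]|AB]; first by rewrite !inE => /orP[] /eqP->; [left|right].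
  by apply/cov; case: AB => ?; [exists A | exists B]; rewrite // !inE eqxx ?orbT.
rewrite E; split=> [/orP[] ?|[D]]; first by exists A; rewrite ?inE ?eqxx.
  by exists B; rewrite // !inE eqxx orbT.
by rewrite !inE => /orP[] /eqP-> ->; rewrite ?orbT.
Qed.

End BooleanRankTheory.

Lemma brank_tens (m n p q : nat) (A : 'M[bool]_(m, n)) (B : 'M[bool]_(p, q)) :
  brank (A *t B)%R <= brank A * brank B.
Proof.
have [F /rectangle_coverP[oF cF] <-] := brank_cover A.
have [G /rectangle_coverP[oG cG] <-] := brank_cover B.
pose tens (x : rectangle m n * rectangle p q) : rectangle (m * p) (n * q) :=
  ([set i | ((mxtens_unindex i).1 \in x.1.1) && ((mxtens_unindex i).2 \in x.2.1)],
   [set j | ((mxtens_unindex j).1 \in x.1.2) && ((mxtens_unindex j).2 \in x.2.2)]).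
rewrite -cardsX; apply: leq_trans (leq_imset_card tens _); apply: brank_le.
apply/rectangle_coverP; split=> [_ /imsetP[[r s] /setXP[rF sG] ->] i j|i j].
  rewrite !inE mxE => /andP[i1 i2] /andP[j1 j2].
  by rewrite (oF r rF _ _ i1 j1) (oG s sG _ _ i2 j2).
rewrite mxE => /andP[/cF[r rF /andP[i1 j1]] /cG[s sG /andP[i2 j2]]].
exists (tens (r, s)); first by rewrite imset_f ?inE ?rF.
by rewrite !inE /= i1 i2 j1 j2.
Qed.

(** The pairing 1-1, 2-3, 3-2 is a bijection between the parts of [A] and of [B]. Two 2-subsets of a
    3-set meet, so some pair has a 1 in both factors. The parts of rank 1 sit in different pairs. *)
Lemma brank_tens_coverable (m n p q k l : nat)
    (A : 'M[bool]_(m, n)) (B : 'M[bool]_(p, q)) :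
  coverable k k 1 A -> coverable l l 1 B -> brank (A *t B)%R <= k * l + k + l.
Proof.
move=> [A1 [A2 [A3 [[a1 a2 a3]]]]] [/coversP A12 /coversP A13 /coversP A23].
move=> [B1 [B2 [B3 [[b1 b2 b3]]]]] [/coversP B12 /coversP B13 /coversP B23].
(* An entrywise disjunction, because matrix addition over [bool] would be exclusive or. *)
pose D := (\matrix_(i, j) ((A1 *t B1)%R i j || (A2 *t B3)%R i j))%R.
have le1 : brank D <= k * l + k * 1.
  apply: leq_trans (leq_add (leq_mul a1 b1) (leq_mul a2 b3)).
  apply: leq_trans (leq_add (brank_tens A1 B1) (brank_tens A2 B3)).
  by apply: brank_union => i j; rewrite mxE.
have : brank (A *t B)%R <= (k * l + k * 1) + 1 * l; last by rewrite muln1 mul1n.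
apply: leq_trans (leq_add le1 (leq_mul a3 b2)).
apply: leq_trans (leq_add (leqnn _) (brank_tens A3 B2)).
apply: brank_union => i j; rewrite !mxE.
move: (mxtens_unindex i) (mxtens_unindex j) => [i1 i2] [j1 j2] /=.
rewrite -[LHS]/(A i1 j1 && B i2 j2) -[(A1 _ _ * _)%R]/(A1 i1 j1 && B1 i2 j2).
rewrite -[(A2 _ _ * _)%R]/(A2 i1 j1 && B3 i2 j2) -[(A3 _ _ * _)%R]/(A3 i1 j1 && B2 i2 j2).
move: (A12 i1 j1) (A13 i1 j1) (A23 i1 j1) (B12 i2 j2) (B13 i2 j2) (B23 i2 j2).
case: (A i1 j1) (A1 i1 j1) (A2 i1 j1) (A3 i1 j1) => [] [] [] [] //;
by case: (B i2 j2) (B1 i2 j2) (B2 i2 j2) (B3 i2 j2) => [] [] [] [].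
Qed.

(** * The matrices [cmx n] *)

(** For [i != j] with [a i] contained in [a j], a rectangle covering entry [(i, j)] would also
    contain row [j], hence the zero entry [(j, j)]. *)
Lemma sigma_le_brank (n : nat) : sigma n <= brank (cmx n).
Proof.
have [F /rectangle_coverP[ones cov] FE] := brank_cover (cmx n).
rewrite /sigma; case: ex_minnP => k _; apply.
pose a (i : 'I_n) : {set 'I_#|F|} := 
  [set x : 'I_#|F| | i \in (enum_val x : rectangle n n).1].
rewrite -FE -[X in X <= _]card_ord; apply: (sperner (a := a)) => i j aij.
apply/eqP/negPn/negP=> ij; have [|r rF /andP[ir jr]] := cov i j; first by rewrite mxE.
have := subsetP aij (enum_rank_in rF r); rewrite !inE enum_rankK_in // => /(_ ir) jr1.
by have := ones r rF _ _ jr1 jr; rewrite mxE eqxx.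
Qed.

(** The central binomial coefficient of 4 is only 6. *)
Lemma sigma_ge5 (n : nat) : 7 <= n -> 5 <= sigma n.
Proof.
rewrite /sigma; case: ex_minnP => k kn _ n7; rewrite leqNgt; apply/negP=> k5.
by have := leq_trans n7 kn; case: k k5 {kn} => [|[|[|[|[|]]]]].
Qed.

(** * Coverings from two-level labellings *)

Section InclusionMatrix.

Variables n m : nat.

Definition noninclmx (a : 'I_n -> {set 'I_m}) : 'M[bool]_n :=
  (\matrix_(i, j) ~~ (a i \subset a j))%R.

Lemma brank_noninclmx (a : 'I_n -> {set 'I_m}) : brank (noninclmx a) <= m.
Proof.
rewrite -[X in _ <= X]card_ord.
apply: (brank_le_family (g := fun x => ([set i | x \in a i], [set j | x \notin a j]))).
  by move=> x i j; rewrite !inE mxE => xi xj; apply/subsetPn; exists x.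
by move=> i j; rewrite mxE => /subsetPn[x xi xj]; exists x; rewrite !inE xi.
Qed.

Variables (t : nat) (U : pred 'I_n).

Lemma two_level_inclusion (a : 'I_n -> {set 'I_m}) i j :
  injective a -> (forall i, #|a i| = t + U i) -> a i \subset a j ->
  i = j \/ ~~ U i && U j.
Proof.
move=> inj card sub; have := subset_leq_card sub; rewrite !card.
case Ui: (U i); case Uj: (U j) => le; [left | lia | by right | left].
  by apply: inj; apply/eqP; rewrite eqEcard sub !card Ui Uj leqnn.
by apply: inj; apply/eqP; rewrite eqEcard sub !card Ui Uj leqnn.
Qed.

(** Both labellings share [U], so the proper inclusions lost by either one lie in the single
    rectangle [A3]; by the last hypothesis none is lost by both. *)
Lemma coverable_two_labellings (a b : 'I_n -> {set 'I_m}) :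
  injective a -> injective b ->
  (forall i, #|a i| = t + U i) -> (forall i, #|b i| = t + U i) ->
  (forall i j, i != j -> a i \subset a j -> ~~ (b i \subset b j)) ->
  coverable m m 1 (cmx n).
Proof.
move=> ainj binj ca cb ab.
pose A3 : 'M[bool]_n := (\matrix_(i, j) (~~ U i && U j))%R.
exists (noninclmx a), (noninclmx b), A3; split.
  split; [exact: brank_noninclmx | exact: brank_noninclmx |].
  rewrite -card_unit; apply: (brank_le_family (g := fun=> ([set i | ~~ U i], [set j | U j]))).
    by move=> _ i j; rewrite !inE mxE => -> ->.
  by move=> i j; rewrite mxE => ij; exists tt; rewrite !inE.
split; apply/coversP=> i j; rewrite !mxE; case: (eqVneq i j) => [->|ij].
- by rewrite !subxx.
- by case: (boolP (a i \subset a j)) => //= /(ab _ _ ij) ->.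
- by rewrite subxx andNb.
- case: (boolP (a i \subset a j)) => //= /(two_level_inclusion ainj ca)[] E.
    by rewrite E eqxx in ij.
  by rewrite E.
- by rewrite subxx andNb.
- case: (boolP (b i \subset b j)) => //= /(two_level_inclusion binj cb)[] E.
    by rewrite E eqxx in ij.
  by rewrite E.
Qed.

End InclusionMatrix.

(** Pascal's rule counts levels [t] and [t.+1] together. The self-referential size formula confines
    sizes to these two, in the shape [t + U i]. *)
Lemma ex_two_level_labelling (n m t : nat) : n <= 'C(m.+1, t.+1) ->
  exists2 a : 'I_n -> {set 'I_m}, injective a & forall i, #|a i| = t + (#|a i| == t.+1).
Proof.
pose L s : {set {set 'I_m}} := [set A : {set 'I_m} | #|A| == s].
have dis : [disjoint L t.+1 & L t].
  by rewrite -setI_eq0; apply/eqP/setP=> A; rewrite !inE; lia.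
rewrite binS -{1 2}(card_ord m) -!card_draws -/(L _) -/(L _).
have -> : #|L t.+1| + #|L t| = #|L t.+1 :|: L t|.
  by apply/esym/eqP; rewrite (leq_card_setU _ _).
move=> le; exists (fun i => enum_val (widen_ord le i)) => [i j /enum_val_inj/(congr1 val)/= E|i].
  exact: val_inj.
by have := enum_valP (widen_ord le i); rewrite !inE; lia.
Qed.

Lemma coverable_cmx (n : nat) : 7 <= n -> coverable (sigma n - 1) (sigma n - 1) 1 (cmx n).
Proof.
move=> n7; have k5 := sigma_ge5 n7.
have : n <= 'C(sigma n, uphalf (sigma n)) by rewrite /sigma; case: ex_minnP.
case: (sigma n) k5 => // m m4; rewrite -bin_sub; last lia.
(* Binomial symmetry moves the upper level [t.+1] from [uphalf m.+1] to [m.+1./2], where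
   [ex_level_permutation] applies. *)
rewrite subSS subn0; set t := m.+1./2 - 1.
have -> : m.+1 - uphalf m.+1 = t.+1 by lia.
case/ex_two_level_labelling=> a ainj ca.
have [|rho [rinj rP]] := @ex_level_permutation m t.+1; first lia.
pose U i := #|a i| == t.+1.
pose b i := if U i then rho (a i) else a i.
have cb i : #|b i| = t + U i.
  rewrite /b; case: ifP => Ui; last by rewrite ca -/(U i) Ui.
  by have [-> _] := rP _ (eqP Ui); rewrite addn1.
apply: (coverable_two_labellings (a := a) (b := b) (U := U) (t := t)) => //.
  move=> i j E; have := cb j; rewrite -E cb; move: E; rewrite /b.
  case Ui: (U i); case Uj: (U j) => E; try lia; last by move=> _; apply: ainj.
  by move=> _; apply/ainj/(rinj _ _ (eqP Ui) (eqP Uj)).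
move=> i j ij aij; have := two_level_inclusion ainj ca aij.
case=> [E|/andP[Ui Uj]]; first by rewrite E eqxx in ij.
rewrite /b; apply/negP; rewrite [U i](negPf Ui) [U j]Uj => bij.
have [_ c] := rP _ (eqP Uj).
have : a i \subset a j :&: rho (a j) by rewrite subsetI aij bij.
(* The overlap is 0 for even [m] and 1 for odd [m]; [m4] gives [t >= 1] and [t >= 2]
   respectively. *)
move/subset_leq_card; rewrite c ca (negPf Ui); lia.
Qed.

Theorem theorem5 :
  (forall n : nat, 7 <= n ->
     coverable (sigma n - 1) (sigma n - 1) 1 (cmx n)) /\
  (forall n m : nat, 7 <= n -> 7 <= m ->
     brank (cmx n *t cmx m)%R < brank (cmx n) * brank (cmx m)).
Proof.
split=> [|n m n7 m7]; first exact: coverable_cmx.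
apply: leq_trans (leq_mul (sigma_le_brank n) (sigma_le_brank m)).
have := brank_tens_coverable (coverable_cmx n7) (coverable_cmx m7).
have := sigma_ge5 n7; have := sigma_ge5 m7; nia.
Qed.
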